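(* Let $L\ge 2$, let $f:\mathbb{R}^{n_0}\to\mathbb{R}^{n_L}$ be a feed-forward ReLU network with fixed weights $\mathbf{W}_\ell\in\mathbb{R}^{n_\ell\times n_{\ell-1}}$ and biases $\mathbf{b}_\ell\in\mathbb{R}^{n_\ell}$, $\ell=1,\dots,L$. Let the input $\mathbf{x}$ be a random vector in $\mathbb{R}^{n_0}$ distributed as a mixture of Gaussians, with probability density $p_{\mathbf{x}}(\mathbf{x})=\sum_{k=1}^K\alpha_k\,\mathcal{N}(\mathbf{x};\boldsymbol{\mu}_k,\boldsymbol{\Sigma}_k)$, where each $\boldsymbol{\Sigma}_k$ is positive definite, $\alpha_k>0$ and $\sum_{k=1}^K\alpha_k=1$. Let $\boldsymbol{\zeta}$ be the (random) activation pattern induced by $\mathbf{x}$. Fix $\boldsymbol{\zeta}'\in\{0,1\}^{\sum_{\ell=1}^{L-1}n_\ell}$ and let $$\widetilde{\boldsymbol{\mu}}_{k,\boldsymbol{\zeta}'}=\overline{\mathbf{C}}^{(L-1)}_{\boldsymbol{\zeta}'}\boldsymbol{\mu}_k+\overline{\mathbf{d}}^{(L-1)}_{\boldsymbol{\zeta}'},\qquad \widetilde{\boldsymbol{\Sigma}}_{k,\boldsymbol{\zeta}'}=\overline{\mathbf{C}}^{(L-1)}_{\boldsymbol{\zeta}'}\,\boldsymbol{\Sigma}_k\,\bigl(\overline{\mathbf{C}}^{(L-1)}_{\boldsymbol{\zeta}'}\bigr)^{\top}.$$ If $\widetilde{\boldsymbol{\Sigma}}_{k,\boldsymbol{\zeta}'}$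 is invertible for all $k\in\{1,\dots,K\}$, then $$P(\boldsymbol{\zeta}=\boldsymbol{\zeta}')=\sum_{k=1}^K\alpha_k\int_{\mathcal{O}(\boldsymbol{\zeta}')}\mathcal{N}\bigl(\mathbf{x};\widetilde{\boldsymbol{\mu}}_{k,\boldsymbol{\zeta}'},\widetilde{\boldsymbol{\Sigma}}_{k,\boldsymbol{\zeta}'}\bigr)\,d\mathbf{x}.$$
   Context: Network: on input $\mathbf{x}\in\mathbb{R}^{n_0}$, $\mathbf{h}_1=\mathbf{W}_1\mathbf{x}+\mathbf{b}_1$, $\mathbf{h}_\ell=\mathbf{W}_\ell\,\mathrm{relu}(\mathbf{h}_{\ell-1})+\mathbf{b}_\ell$ for $\ell=2,\dots,L$, and $f(\mathbf{x})=\mathbf{h}_L$, where $\mathrm{relu}$ applies $t\mapsto\max(0,t)$ entrywise. Sign function: for a vector $\mathbf{v}$, $\mathbb{1}(\mathbf{v})$ is the binary vector with $\mathbb{1}(\mathbf{v})_i=1$ if $v_i>0$ and $\mathbb{1}(\mathbf{v})_i=0$ otherwise. Activation pattern: the activation pattern induced by input $\mathbf{x}$ is $\boldsymbol{\zeta}=[\mathbb{1}(\mathbf{h}_1)^\top,\dots,\mathbb{1}(\mathbf{h}_{L-1})^\top]^\top\in\{0,1\}^{\sum_{\ell=1}^{L-1}n_\ell}$. Affine parameters attached to a binary vector: for $\boldsymbol{\zeta}'=[\mathbf{z}_1^\top,\dots,\mathbf{z}_{L-1}^\top]^\top$ with $\mathbf{z}_\ell\in\{0,1\}^{n_\ell}$,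 set $\mathbf{C}_1=\mathbf{W}_1$, $\mathbf{d}_1=\mathbf{b}_1$ and, for $\ell=2,\dots,L$, $\mathbf{C}_\ell=\mathbf{W}_\ell\,\mathrm{diag}[\mathbf{z}_{\ell-1}]\,\mathbf{C}_{\ell-1}$, $\mathbf{d}_\ell=\mathbf{W}_\ell\,\mathrm{diag}[\mathbf{z}_{\ell-1}]\,\mathbf{d}_{\ell-1}+\mathbf{b}_\ell$. The matrix $\overline{\mathbf{C}}^{(\ell)}_{\boldsymbol{\zeta}'}$ is obtained by stacking $\mathbf{C}_1,\dots,\mathbf{C}_\ell$ vertically, and the vector $\overline{\mathbf{d}}^{(\ell)}_{\boldsymbol{\zeta}'}$ by stacking $\mathbf{d}_1,\dots,\mathbf{d}_\ell$. Orthant: for $\boldsymbol{\zeta}'\in\{0,1\}^n$, $\mathcal{O}(\boldsymbol{\zeta}')=\{\mathbf{v}\in\mathbb{R}^n:\mathbb{1}(\mathbf{v})=\boldsymbol{\zeta}'\}$. $\mathcal{N}(\cdot;\boldsymbol{\mu},\boldsymbol{\Sigma})$ denotes the multivariate normal density with mean $\boldsymbol{\mu}$ and covariance $\boldsymbol{\Sigma}$. In the integral, the dummy variable $\mathbf{x}$ ranges over $\mathcal{O}(\boldsymbol{\zeta}')\subset\mathbb{R}^{\sum_{\ell=1}^{L-1}n_\ell}$. *)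

(* Defs.v *)
From HB Require Import structures.
From mathcomp Require Import all_boot all_order all_algebra.
From mathcomp Require Import all_classical all_reals all_analysis.

Set Implicit Arguments.
Unset Strict Implicit.
Unset Printing Implicit Defensive.

Import Order.TTheory GRing.Theory Num.Theory.
Import numFieldNormedType.Exports.

Local Open Scope classical_set_scope.
Local Open Scope ring_scope.

Fact measure_matrix_display : measure_display.
Proof. exact: default_measure_display. Qed.

Section measurable_matrix.
Context {R : realType} (m n : nat).

Definition matrix_cylinders : set (set 'M[R]_(m, n)) :=
  \bigcup_(ij : 'I_m * 'I_n)
    preimage_set_system setT (fun A : 'M[R]_(m, n) => A ij.1 ij.2) measurable.

Let mx0 : <<s matrix_cylinders >> set0.
Proof. exact: sigma_algebra0. Qed.

Let mxC A : <<s matrix_cylinders >> A -> <<s matrix_cylinders >> (~` A).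
Proof. exact: sigma_algebraC. Qed.

Let mx_bigcup (F : (set 'M[R]_(m, n))^nat) :
  (forall i, <<s matrix_cylinders >> (F i)) ->
  <<s matrix_cylinders >> (\bigcup_i F i).
Proof. exact: sigma_algebra_bigcup. Qed.

(* The product sigma-algebra of the entries, which is also the Borel one. *)
HB.instance Definition _ := @isMeasurable.Build measure_matrix_display
  'M[R]_(m, n) <<s matrix_cylinders >> mx0 mxC mx_bigcup.

End measurable_matrix.

Section measurable_matrix_lemmas.
Context {R : realType}.

Lemma measurable_coord m n (i : 'I_m) (j : 'I_n) :
  measurable_fun [set: 'M[R]_(m, n)] (fun A : 'M[R]_(m, n) => A i j).
Proof.
move=> _ B mB; apply: sub_sigma_algebra; exists (i, j) => //=.
by exists B.
Qed.

Lemma measurable_fun_matrix d (T : measurableType d) m n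
    (f : T -> 'M[R]_(m, n)) :
  (forall i j, measurable_fun [set: T] (fun x => f x i j)) ->
  measurable_fun [set: T] f.
Proof.
move=> mf; apply: (@measurability _ _ _ _ setT f (@matrix_cylinders R m n)).
  by [].
move=> _ [_ [[i j] _ [B mB <-]] <-] /=; rewrite !setTI.
by rewrite -[X in measurable X]setTI; exact: mf.
Qed.

End measurable_matrix_lemmas.

(* Lebesgue measure on column vectors, by recursion on the dimension: up to
   the bijection [cons_cV], the product of Lebesgue measure on the first
   coordinate with the measure on the others.  Each step has to carry the
   sigma-finiteness needed to form the next product. *)
Section lebesgue_cons.
Context {R : realType} (n : nat).

Definition cons_cV (p : measurableTypeR R * 'cV[R]_n) : 'cV[R]_n.+1 :=
  col_mx (p.1%:M : 'cV[R]_1) p.2.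

Definition uncons_cV (v : 'cV[R]_n.+1) : measurableTypeR R * 'cV[R]_n :=
  (usubmx (v : 'cV[R]_(1 + n)) ord0 ord0, dsubmx (v : 'cV[R]_(1 + n))).

Lemma cons_cVK : cancel cons_cV uncons_cV.
Proof.
move=> [a v]; rewrite /uncons_cV /cons_cV /= col_mxKu col_mxKd mxE eqxx mulr1n.
by [].
Qed.

Lemma uncons_cVK : cancel uncons_cV cons_cV.
Proof.
move=> v; rewrite /cons_cV /uncons_cV /= -[RHS](@vsubmxK _ 1 n).
by rewrite -mx11_scalar.
Qed.

Lemma cons_cV0 p j : cons_cV p ord0 j = p.1.
Proof.
have -> : (ord0 : 'I_n.+1) = lshift n (ord0 : 'I_1) by exact/val_inj.
by apply: etrans (col_mxEu _ _ _ _) _; rewrite (ord1 j) mxE eqxx mulr1n.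
Qed.

Lemma cons_cV_lift p i j : cons_cV p (lift ord0 i) j = p.2 i j.
Proof.
have -> : lift ord0 i = rshift 1 i by exact/val_inj.
exact: (@col_mxEd _ 1 n 1).
Qed.

Lemma measurable_cons_cV : measurable_fun [set: _] cons_cV.
Proof.
apply: measurable_fun_matrix => i j; case: (unliftP ord0 i) => [k|] ->.
- apply: (eq_measurable_fun
    ((fun v : 'cV[R]_n => v k j) \o snd)) => [p _|].
    by rewrite cons_cV_lift.
  by apply: measurableT_comp => //; exact: measurable_coord.
- apply: (eq_measurable_fun fst) => [p _|]; first by rewrite cons_cV0.
  exact: measurable_fst.
Qed.

Lemma measurable_uncons_cV : measurable_fun [set: _] uncons_cV.
Proof.
apply: measurable_fun_pair => /=.
  rewrite (_ : (fun _ => _) = fun v : 'cV[R]_n.+1 => v ord0 ord0).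
    exact: measurable_coord.
  by apply/funext => v; rewrite mxE; congr (v _ _); exact/val_inj.
apply: measurable_fun_matrix => i j.
rewrite (_ : (fun _ => _) = fun v : 'cV[R]_n.+1 => v (lift ord0 i) j).
  exact: measurable_coord.
by apply/funext => v; rewrite mxE; congr (v _ _); exact/val_inj.
Qed.

Variable mu : {sigma_finite_measure set 'cV[R]_n -> \bar R}.

Definition lebesgue_cons : set 'cV[R]_n.+1 -> \bar R :=
  pushforward (@lebesgue_measure R \x mu)%E cons_cV.

Let lebesgue_cons0 : lebesgue_cons set0 = 0%E.
Proof. by rewrite /lebesgue_cons /pushforward preimage_set0 measure0. Qed.

Let lebesgue_cons_ge0 A : (0 <= lebesgue_cons A)%E.
Proof. by rewrite /lebesgue_cons /pushforward; exact: measure_ge0. Qed.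

Let lebesgue_cons_sigma_additive : semi_sigma_additive lebesgue_cons.
Proof.
move=> F mF tF mUF; rewrite /lebesgue_cons /pushforward preimage_bigcup.
apply: measure_semi_sigma_additive.
- by move=> k; rewrite -[X in measurable X]setTI; exact: measurable_cons_cV.
- apply/trivIsetP => /= i j _ _ ij; rewrite -preimage_setI.
  by move/trivIsetP : tF => /(_ _ _ _ _ ij) ->//; rewrite preimage_set0.
- by rewrite -preimage_bigcup -[X in measurable X]setTI; exact: measurable_cons_cV.
Qed.

HB.instance Definition _ := isMeasure.Build _ _ _ lebesgue_cons
  lebesgue_cons0 lebesgue_cons_ge0 lebesgue_cons_sigma_additive.

Let lebesgue_cons_sigma_finite : sigma_finite [set: 'cV[R]_n.+1] lebesgue_cons.
Proof.
have /sigma_finiteP[F [TF ndF Foo]] := sigma_finiteT (@lebesgue_measure R).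
have /sigma_finiteP[G [TG ndG Goo]] := sigma_finiteT mu.
exists (fun k => uncons_cV @^-1` (F k `*` G k)) => [|k].
  apply/esym; rewrite -subTset => v _.
  have [i _ Fi] : (\bigcup_i F i) (uncons_cV v).1 by rewrite -TF.
  have [j _ Gj] : (\bigcup_j G j) (uncons_cV v).2 by rewrite -TG.
  exists (maxn i j) => //; split.
    by move: Fi; exact/subsetPset/ndF/leq_maxl.
  by move: Gj; exact/subsetPset/ndG/leq_maxr.
have [[mF Fk] [mG Gk]] := (Foo k, Goo k); split.
  rewrite -[X in measurable X]setTI; apply: measurable_uncons_cV => //.
  exact: measurableX.
rewrite /lebesgue_cons /pushforward -comp_preimage.
rewrite (_ : uncons_cV \o cons_cV = id); last exact/funext/cons_cVK.
by rewrite preimage_id product_measure1E // lte_mul_pinfty // ge0_fin_numE.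
Qed.

HB.instance Definition _ := Measure_isSigmaFinite.Build _ _ _ lebesgue_cons
  lebesgue_cons_sigma_finite.

End lebesgue_cons.

Fixpoint lebesgue_cV (R : realType) (n : nat) :
    {sigma_finite_measure set 'cV[R]_n -> \bar R} :=
  match n with
  | 0 => dirac (0 : 'cV[R]_0)
  | k.+1 => lebesgue_cons (lebesgue_cV R k)
  end.

Lemma lebesgue_cV_box (R : realType) (n : nat)
    (B : 'I_n -> set (measurableTypeR R)) :
  (forall i, measurable (B i)) ->
  lebesgue_cV R n [set v | forall i, B i (v i ord0)] =
  (\prod_(i < n) lebesgue_measure (B i))%E.
Proof.
elim: n B => [|n IHn] B mB.
  by rewrite big_ord0 /= diracE mem_set // => -[].
rewrite big_ord_recl -(IHn (fun i => B (lift ord0 i))) //.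
have mbox : measurable [set v : 'cV[R]_n | forall i, B (lift ord0 i) (v i ord0)].
  rewrite (_ : mkset _ = \bigcap_(i in [set: 'I_n])
      ((fun v : 'cV[R]_n => v i ord0) @^-1` B (lift ord0 i))); last first.
    by apply/seteqP; split => v /= h i; [move=> _; exact: h|exact: (h i I)].
  apply: fin_bigcap_measurable => // i _.
  rewrite -[X in measurable X]setTI.
  exact: (@measurable_coord R n 1 i ord0 measurableT _ (mB (lift ord0 i))).
rewrite -product_measure1E //=; congr product_measure1.
apply/seteqP; split => -[a v] /= h.
  split=> [|i]; first by have := h ord0; rewrite cons_cV0.
  by have := h (lift ord0 i); rewrite cons_cV_lift.
case: h => h0 h i; case: (unliftP ord0 i) => [k|] ->.
  by rewrite cons_cV_lift; exact: h.
by rewrite cons_cV0.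
Qed.
Section gaussian.
Context {R : realType} (n : nat).

Definition posdefmx (S : 'M[R]_n) : Prop :=
  S^T = S /\ forall v : 'cV[R]_n, v != 0 -> 0 < (v^T *m S *m v) ord0 ord0.

Definition mvn_pdf (mu : 'cV[R]_n) (S : 'M[R]_n) (x : 'cV[R]_n) : R :=
  (Num.sqrt ((2 * pi) ^+ n * \det S))^-1 *
  expR (- ((x - mu)^T *m invmx S *m (x - mu)) ord0 ord0 / 2).

Definition has_density d (T : measurableType d) (P : probability T R)
    (X : {RV P >-> 'cV[R]_n}) (p : 'cV[R]_n -> R) : Prop :=
  forall A : set 'cV[R]_n, measurable A ->
    distribution P X A = (\int[lebesgue_cV R n]_(x in A) (p x)%:E)%E.

End gaussian.

Section sign.
Context {R : realType} (n : nat).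

Definition relu (v : 'cV[R]_n) : 'cV[R]_n := map_mx (fun t => Num.max 0 t) v.

Definition sign_cV (v : 'cV[R]_n) : 'cV[bool]_n := map_mx (fun t => 0 < t) v.

Definition orthant (z : 'cV[bool]_n) : set 'cV[R]_n :=
  [set v | sign_cV v = z].

Definition mask_mx (z : 'cV[bool]_n) : 'M[R]_n :=
  diag_mx (\row_i (z i ord0)%:R).

End sign.

(* Layers are numbered from 0: [W l], [b l] and every quantity attached to
   layer [l] below is the one of index [l + 1] in the usual numbering from 1,
   while [n l] is the width n_l (input included).  A network of depth [L] uses
   only the entries with [l < L] of the families [W] and [b]. *)
Section network.
Context {R : realType} (n : nat -> nat).
Variables (W : forall l, 'M[R]_(n l.+1, n l)) (b : forall l, 'cV[R]_(n l.+1)).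

Definition stacked_dim (m : nat) : nat := \sum_(l < m) n l.+1.

Fixpoint preactivation (x : 'cV[R]_(n 0%N)) (l : nat) : 'cV[R]_(n l.+1) :=
  match l with
  | 0 => W 0%N *m x + b 0%N
  | k.+1 => W k.+1 *m relu (preactivation x k) + b k.+1
  end.

Definition activation_pattern (L : nat) (x : 'cV[R]_(n 0%N)) :
    'cV[bool]_(stacked_dim L.-1) :=
  \mxcol_(l < L.-1) sign_cV (preactivation x l).

(* The block z_{l+1} of a binary vector; the value for [l >= m] is a dummy. *)
Definition pattern_block (m : nat) (zeta : 'cV[bool]_(stacked_dim m))
    (l : nat) : 'cV[bool]_(n l.+1) :=
  match (l < m)%N =P true with
  | ReflectT lt_lm =>
      @submxcol _ m (fun i : 'I_m => n i.+1) 1 zeta (Ordinal lt_lm)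
  | ReflectF _ => const_mx false
  end.

Section affine.
Variables (m : nat) (zeta : 'cV[bool]_(stacked_dim m)).

Fixpoint affine_mx (l : nat) : 'M[R]_(n l.+1, n 0%N) :=
  match l with
  | 0 => W 0%N
  | k.+1 => W k.+1 *m mask_mx (pattern_block zeta k) *m affine_mx k
  end.

Fixpoint affine_cV (l : nat) : 'cV[R]_(n l.+1) :=
  match l with
  | 0 => b 0%N
  | k.+1 => W k.+1 *m mask_mx (pattern_block zeta k) *m affine_cV k + b k.+1
  end.

Definition stacked_mx (p : nat) : 'M[R]_(stacked_dim p, n 0%N) :=
  \mxcol_(l < p) affine_mx l.

Definition stacked_cV (p : nat) : 'cV[R]_(stacked_dim p) :=
  \mxcol_(l < p) affine_cV l.

End affine.

End network.

(* Main.v *)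
(* On the event zeta = zeta', each preactivation agrees with its affine
   surrogate C_l x + d_l, and conversely if all the surrogates have the signs
   prescribed by zeta', they are the preactivations; so zeta = zeta' amounts to
   C x + d being in the orthant of zeta'.  It remains to push each Gaussian
   component forward by x |-> C x + d.  Invertibility of C Sigma C^T makes C of
   full row rank; rows D spanning the Sigma-orthogonal complement complete it
   to an invertible B with B Sigma B^T block diagonal.  The linear change of
   variables y = B x then splits the density into that of C x times a Gaussian
   density in D x, which integrates to 1. *)
Require Import Defs.
From mathcomp Require Import all_boot all_order all_algebra.
From mathcomp Require Import all_classical all_reals all_analysis.
From mathcomp Require Import measurable_realfun.
From mathcomp Require Import ring.

Set Implicit Arguments.
Unset Strict Implicit.
Unset Printing Implicit Defensive.

Import Order.TTheory GRing.Theory Num.Theory.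
Import numFieldNormedType.Exports.

Local Open Scope classical_set_scope.
Local Open Scope ring_scope.

(** * Measurability and iterated integrals on column vectors *)

Section integration_cV.
Context {R : realType}.

Lemma measurable_mulmx_addr m n (B : 'M[R]_(m, n)) (t : 'cV[R]_m) :
  measurable_fun [set: 'cV[R]_n] (fun x : 'cV[R]_n => B *m x + t).
Proof.
apply: measurable_fun_matrix => i j.
rewrite (_ : (fun _ => _) =
    (fun x : 'cV[R]_n => \sum_k B i k * x k j + t i j)); last first.
  by apply/funext => x; rewrite !mxE.
apply: measurable_funD => //; apply: measurable_sum => k.
by apply: measurable_funM => //; exact: measurable_coord.
Qed.

Lemma measurable_col_mx m k :
  measurable_fun setT (fun p : 'cV[R]_m * 'cV[R]_k => col_mx p.1 p.2).
Proof.
apply: measurable_fun_matrix => i j; case: (split_ordP i) => i' ->.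
  apply: (eq_measurable_fun
      ((fun v : 'cV[R]_m => v i' j) \o fst)) => [p _|].
    by rewrite col_mxEu.
  by apply: measurableT_comp => //; exact: measurable_coord.
apply: (eq_measurable_fun
    ((fun v : 'cV[R]_k => v i' j) \o snd)) => [p _|].
  by rewrite col_mxEd.
by apply: measurableT_comp => //; exact: measurable_coord.
Qed.

(** Lebesgue measure and [|a|] times its pushforward under [x |-> a * x + t] agree on half-open
    intervals, hence on all measurable sets. *)
Lemma integral_affine1 (a t : R) (g : R -> \bar R) : a != 0 ->
  measurable_fun [set: R] g -> (forall x, 0 <= g x)%E ->
  (\int[lebesgue_measure]_x g x =
   `|a|%R%:E * \int[lebesgue_measure]_x g (a * x + t)%R)%E.
Proof.
move=> a0 mg g0.
pose phi : measurableTypeR R -> measurableTypeR R := fun x => a * x + t.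
have mphi : measurable_fun setT phi.
  by apply: measurable_funD => //; exact: measurable_funM.
pose push : {measure set (measurableTypeR R) -> \bar R} :=
  measure_function_pushforward__canonical__measure_function_Measure
    (@lebesgue_measure R) mphi.
pose nu := mscale (NngNum (normr_ge0 a)) push.
have eqnu A : measurable A -> lebesgue_measure A = nu A.
  apply: lebesgue_measure_unique => X.
  move=> /ocitvP[->|[[u v] /= uv ->]]; first by rewrite !measure0.
  rewrite lebesgue_measure_itv /= lte_fin uv /nu /mscale /= /pushforward /=.
  have [lta|gta|/eqP] := ltgtP a 0; last by rewrite (negbTE a0).
  (* For [a < 0] the map reverses the order, so the preimage is closed on the left and open on the
     right. *)
  - rewrite (_ : _ @^-1` _ = `[(v - t) / a, (u - t) / a[%classic); last first.
      apply/seteqP; split => x /=; rewrite !in_itv /= /phi.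
        move=> /andP[h1 h2]; rewrite ler_ndivrMr// ltr_ndivlMr// mulrC.
        by rewrite lerBrDr ltrBlDr h2 h1.
      move=> /andP[]; rewrite ler_ndivrMr// ltr_ndivlMr// mulrC.
      by rewrite lerBrDr ltrBlDr => -> ->.
    rewrite lebesgue_measure_itv /= lte_fin ltr_nM2r ?invr_lt0// ltrD2r uv.
    rewrite ltr0_norm// -!EFinB -EFinM; congr _%:E.
    by rewrite -mulrBl mulrCA mulNr divff// mulrN1 !opprB addrA subrK.
  - rewrite (_ : _ @^-1` _ = `](u - t) / a, (v - t) / a]%classic); last first.
      apply/seteqP; split => x /=; rewrite !in_itv /= /phi.
        move=> /andP[h1 h2]; rewrite ler_pdivlMr// ltr_pdivrMr// mulrC.
        by rewrite lerBrDr ltrBlDr h2 h1.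
      move=> /andP[]; rewrite ler_pdivlMr// ltr_pdivrMr// mulrC.
      by rewrite lerBrDr ltrBlDr => -> ->.
    rewrite lebesgue_measure_itv /= lte_fin ltr_pM2r ?invr_gt0// ltrD2r uv.
    rewrite gtr0_norm// -!EFinB -EFinM; congr _%:E.
    by rewrite -mulrBl mulrCA divff// mulr1 opprB addrA subrK.
rewrite (eq_measure_integral nu) => [|A mA _]; last exact: eqnu.
rewrite ge0_integral_mscale//=; congr (_ * _)%E.
by rewrite ge0_integral_pushforward.
Qed.

Lemma integral_cons_cV n (g : 'cV[R]_n.+1 -> \bar R) :
  measurable_fun setT g -> (forall x, 0 <= g x)%E ->
  (\int[lebesgue_cV R n.+1]_x g x =
   \int[lebesgue_measure]_a \int[lebesgue_cV R n]_v g (cons_cV (a, v)))%E.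
Proof.
move=> mg g0; have mgc := measurableT_comp mg (@measurable_cons_cV R n).
rewrite [LHS]ge0_integral_pushforward ?preimage_setT//; last first.
  exact: measurable_cons_cV.
exact: (@fubini_tonelli1 _ _ _ _ R lebesgue_measure (lebesgue_cV R n) _ mgc
  (fun p => g0 _)).
Qed.

(** This order of integration serves block upper triangular maps, which move the first coordinate by
    an amount depending on the others. *)
Lemma integral_cons_cVC n (g : 'cV[R]_n.+1 -> \bar R) :
  measurable_fun setT g -> (forall x, 0 <= g x)%E ->
  (\int[lebesgue_cV R n.+1]_x g x =
   \int[lebesgue_cV R n]_v \int[lebesgue_measure]_a g (cons_cV (a, v)))%E.
Proof.
move=> mg g0; have mgc := measurableT_comp mg (@measurable_cons_cV R n).
rewrite [LHS]ge0_integral_pushforward ?preimage_setT//; last first.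
  exact: measurable_cons_cV.
exact: (@fubini_tonelli2 _ _ _ _ R lebesgue_measure (lebesgue_cV R n) _ mgc
  (fun p => g0 _)).
Qed.

Lemma measurable_cons_cV_l n (a : R) :
  measurable_fun setT (fun v : 'cV[R]_n => cons_cV (a, v)).
Proof. exact: measurableT_comp (@measurable_cons_cV R n) _. Qed.

Lemma measurable_cons_cV_r n (v : 'cV[R]_n) :
  measurable_fun setT (fun a : measurableTypeR R => cons_cV (a, v)).
Proof. exact: measurableT_comp (@measurable_cons_cV R n) _. Qed.

Lemma integral_cV0 (g : 'cV[R]_0 -> \bar R) : measurable_fun setT g ->
  (\int[lebesgue_cV R 0]_x g x = g 0%R)%E.
Proof. by move=> mg; rewrite /= integral_dirac//= diracT mul1e. Qed.

(** The measure is built one coordinate at a time, so the upper block is peeled off by induction on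
    its size, with Tonelli at each step. *)
Lemma integral_col_mx m k (g : 'cV[R]_(m + k) -> \bar R) :
  measurable_fun setT g -> (forall x, 0 <= g x)%E ->
  (\int[lebesgue_cV R (m + k)]_x g x =
   \int[lebesgue_cV R m]_u \int[lebesgue_cV R k]_v g (col_mx u v))%E.
Proof.
elim: m g => [|m IHm] g mg g0.
  rewrite [RHS]integral_cV0; last first.
    have h := measurableT_comp mg (@measurable_col_mx 0 k).
    exact: (@measurable_fun_fubini_tonelli_F _ _ _ _ R (lebesgue_cV R k) _ h
      (fun p => g0 _)).
  apply: eq_integral => v _; congr g; apply/matrixP => i j.
  have -> : i = rshift 0 i by exact/val_inj.
  by rewrite col_mxEd; congr (v _ _); exact/val_inj.
have h := measurableT_comp mg (@measurable_col_mx m.+1 k).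
rewrite [LHS](@integral_cons_cV (m + k))// integral_cons_cV; last 2 first.
- exact: (@measurable_fun_fubini_tonelli_F _ _ _ _ R (lebesgue_cV R k) _ h
      (fun p => g0 _)).
- by move=> x; exact: integral_ge0.
apply: eq_integral => a _; rewrite IHm//; last first.
  exact: measurableT_comp mg (@measurable_cons_cV_l _ _).
apply: eq_integral => u _; apply: eq_integral => v _; congr g.
apply/matrixP => i j; case: (unliftP ord0 i) => [i'|] ->.
  rewrite cons_cV_lift /=; case: (split_ordP i') => i'' ->;
    rewrite ?col_mxEu ?col_mxEd.
    have -> : lift ord0 (lshift k i'') = lshift k (lift ord0 i'').
      exact/val_inj.
    by rewrite col_mxEu cons_cV_lift.
  have -> : lift ord0 (rshift m i'') = rshift m.+1 i'' by exact/val_inj.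
  by rewrite col_mxEd.
rewrite cons_cV0 /=; have -> : ord0 = lshift k (@ord0 m) by exact/val_inj.
by rewrite col_mxEu cons_cV0.
Qed.

End integration_cV.

(** * Translations and invertible linear substitutions *)

Section linear_change_of_variables.
Context {R : realType}.

Lemma cons_cVD n (p q : R * 'cV[R]_n) :
  cons_cV p + cons_cV q = cons_cV (p.1 + q.1, p.2 + q.2).
Proof.
apply/matrixP => i j; rewrite mxE; case: (unliftP ord0 i) => [k|] ->.
  by rewrite !cons_cV_lift mxE.
by rewrite !cons_cV0.
Qed.

Lemma mul_block_cons_cV n (a : R) (r : 'rV[R]_n) (s : 'cV[R]_n) (B : 'M[R]_n)
    (x : R) (v : 'cV[R]_n) :
  block_mx a%:M r s B *m cons_cV (x, v) =
  cons_cV (a * x + (r *m v) ord0 ord0, x *: s + B *m v).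
Proof.
apply: etrans (mul_block_col _ _ _ _ _ _) _; congr col_mx => /=.
  by rewrite -scalar_mxM raddfD /= -mx11_scalar.
by rewrite mul_mx_scalar.
Qed.

(** The first coordinate is shifted by the scalar formula with slope 1, the others by induction. *)
Lemma integral_translation_cV n (t : 'cV[R]_n) (g : 'cV[R]_n -> \bar R) :
  measurable_fun setT g -> (forall x, 0 <= g x)%E ->
  (\int[lebesgue_cV R n]_x g x = \int[lebesgue_cV R n]_x g (x + t)%R)%E.
Proof.
elim: n t g => [|n IHn] t g mg g0.
  by apply: eq_integral => x _; congr g; rewrite [t]flatmx0 addr0.
have mgt : measurable_fun setT (fun x : 'cV[R]_n.+1 => g (x + t)).
  apply: (measurableT_comp mg); rewrite (_ : (fun _ => _) =
    (fun x : 'cV[R]_n.+1 => 1%:M *m x + t)); first exact: measurable_mulmx_addr.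
  by apply/funext => x; rewrite mul1mx.
rewrite (integral_cons_cV mg g0) (integral_cons_cV mgt (fun=> g0 _)).
rewrite -(uncons_cVK t); case: (uncons_cV t) => t0 t'.
rewrite (@integral_affine1 _ 1 t0) ?oner_eq0//; last 2 first.
- have h := measurableT_comp mg (@measurable_cons_cV R n).
  exact: (@measurable_fun_fubini_tonelli_F _ _ _ _ R (lebesgue_cV R n) _ h
    (fun p => g0 _)).
- by move=> x; exact: integral_ge0.
rewrite normr1 mul1e; apply: eq_integral => a _.
rewrite (IHn t'); last 2 first.
- exact: measurableT_comp mg (@measurable_cons_cV_l _ _ _).
- by [].
by apply: eq_integral => v _; rewrite cons_cVD mul1r.
Qed.

(** Isolated as a property of [B] so that it can be proved factor by factor along a matrix
    factorization. *)
Definition change_of_variables n (B : 'M[R]_n) :=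
  forall g : 'cV[R]_n -> \bar R,
  measurable_fun setT g -> (forall x, 0 <= g x)%E ->
  (\int[lebesgue_cV R n]_x g x =
   `|\det B|%R%:E * \int[lebesgue_cV R n]_x g (B *m x)%R)%E.

Lemma measurable_mulmx m n (B : 'M[R]_(m, n)) :
  measurable_fun [set: 'cV[R]_n] (mulmx B : 'cV[R]_n -> 'cV[R]_m).
Proof.
rewrite (_ : mulmx B = (fun x : 'cV[R]_n => B *m x + 0)).
  exact: measurable_mulmx_addr.
by apply/funext => x; rewrite addr0.
Qed.

Lemma change_of_variablesM n (A B : 'M[R]_n) :
  change_of_variables A -> change_of_variables B ->
  change_of_variables (A *m B).
Proof.
move=> hA hB g mg g0; rewrite hA// hB//; last first.
  exact: (measurableT_comp mg (measurable_mulmx _)).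
rewrite det_mulmx normrM EFinM muleA; congr (_ * _)%E.
by apply: eq_integral => x _; rewrite mulmxA.
Qed.

(** For a fixed first coordinate [a], the shear only translates the remaining ones by [a *: s]. *)
Lemma change_of_variables_lshear n (s : 'cV[R]_n) :
  change_of_variables (block_mx 1%:M 0 s 1%:M : 'M[R]_(1 + n)).
Proof.
move=> g mg g0; rewrite det_lblock !det1 mulr1 normr1 mul1e.
have mgB := measurableT_comp mg (measurable_mulmx (block_mx 1%:M 0 s 1%:M)).
rewrite [LHS](integral_cons_cV mg g0) [RHS](integral_cons_cV mgB (fun=> g0 _)).
apply: eq_integral => a _; rewrite (@integral_translation_cV _ (a *: s)).
- apply: eq_integral => v _; rewrite /= mul_block_cons_cV !mul1mx mul0mx mul1r.
  by rewrite mxE addr0 addrC.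
- exact: measurableT_comp mg (@measurable_cons_cV_l _ _ _).
- by [].
Qed.

(** With the lower coordinates [v] fixed, the first one undergoes a scalar affine map of slope [a],
    which contributes [|a|]; the map [B] then acts on the partial integral [G]. *)
Lemma change_of_variables_ublock n (a : R) (r : 'rV[R]_n) (B : 'M[R]_n) :
  a != 0 -> change_of_variables B ->
  change_of_variables (block_mx a%:M r 0 B : 'M[R]_(1 + n)).
Proof.
move=> a0 hB g mg g0; rewrite det_ublock det_scalar1 normrM EFinM.
have mgB := measurableT_comp mg (measurable_mulmx (block_mx a%:M r 0 B)).
rewrite [LHS](integral_cons_cVC mg g0).
rewrite [in RHS](integral_cons_cVC mgB (fun=> g0 _)).
pose G v := (\int[lebesgue_measure]_x g (cons_cV (x, v)))%E.
have mG : measurable_fun setT G.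
  have h := measurableT_comp mg (@measurable_cons_cV R n).
  exact: (@measurable_fun_fubini_tonelli_G _ _ _ _ R lebesgue_measure _ h
    (fun p => g0 _)).
have G0 v : (0 <= G v)%E by exact: integral_ge0.
rewrite (hB _ mG G0) (muleC `|a|%R%:E) -muleA; congr (_ * _)%E.
rewrite -ge0_integralZl_EFin//=.
apply: eq_integral => v _.
rewrite /G (@integral_affine1 _ a ((r *m v) ord0 ord0))//.
- congr (_ * _)%E; apply: eq_integral => x _.
  by rewrite /= mul_block_cons_cV scaler0 add0r.
- exact: measurableT_comp mg (@measurable_cons_cV_r _ _ _).
- by move=> x _; exact: integral_ge0.
- exact: (@measurable_fun_fubini_tonelli_G _ _ _ _ R lebesgue_measure _
    (measurableT_comp mgB (@measurable_cons_cV R n)) (fun p => g0 _)).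
Qed.

Lemma change_of_variables1 n : change_of_variables (1%:M : 'M[R]_n).
Proof.
move=> g _ _; rewrite det1 normr1 mul1e.
by apply: eq_integral => x _; rewrite mul1mx.
Qed.

(** A nonzero corner gives a block LU factorization: a lower shear times an upper block matrix whose
    last block is the Schur complement [S], itself invertible. *)
Lemma change_of_variables_pivot n (a : R) (r : 'rV[R]_n) (s : 'cV[R]_n)
    (B : 'M[R]_n) :
  (forall S : 'M[R]_n, S \in unitmx -> change_of_variables S) ->
  a != 0 -> (block_mx a%:M r s B : 'M[R]_(1 + n)) \in unitmx ->
  change_of_variables (block_mx a%:M r s B : 'M[R]_(1 + n)).
Proof.
move=> hS a0; pose S := B - a^-1 *: (s *m r).
have -> : block_mx a%:M r s B =
    block_mx 1%:M 0 (a^-1 *: s) 1%:M *m block_mx a%:M r 0 S :> 'M[R]_(1 + n).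
  rewrite mulmx_block !mul1mx !mul0mx !addr0 mul_mx_scalar scalerA.
  by rewrite divff// scale1r -scalemxAl addrC subrK.
rewrite unitmx_mul => /andP[_].
rewrite unitmxE det_ublock unitrM => /andP[_ uS].
apply: change_of_variablesM; first exact: change_of_variables_lshear.
by apply: change_of_variables_ublock => //; exact: hS.
Qed.

(* When the corner entry vanishes, adding to the first row a row with a nonzero
   first entry creates a pivot. *)
Theorem change_of_variables_unitmx n (B : 'M[R]_n) :
  B \in unitmx -> change_of_variables B.
Proof.
elim: n B => [|n IHn] B uB.
  move=> g mg g0; rewrite det_mx00 normr1 mul1e.
  by apply: eq_integral => x _; rewrite [x]flatmx0 [B *m _]flatmx0.
move: uB; rewrite -[B](@submxK _ 1 n 1 n) [ulsubmx _]mx11_scalar.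
move: (ulsubmx _ _ _) (ursubmx _) (dlsubmx _) (drsubmx _) => a r s B' uB.
have [a0|a0] := eqVneq a 0; last exact: change_of_variables_pivot.
(* With a zero corner, [s = 0] would make the first column, hence the determinant, vanish. *)
have /cV0Pn[i si] : s != 0.
  apply: contraTneq uB => s0.
  by rewrite s0 a0 unitmxE (@det_ublock _ 1 n) det_scalar1 mul0r unitr0.
(* [e] selects the lower row [i]: adding that row to the first puts [s i ord0] in the corner, and
   the factor with [- e] undoes the addition. *)
pose e : 'rV[R]_n := delta_mx ord0 i.
have E : block_mx a%:M r s B' =
    block_mx 1%:M (- e) 0 1%:M *m block_mx (s i ord0)%:M (r + e *m B') s B'
    :> 'M[R]_(1 + n).
  rewrite mulmx_block !mul1mx !mul0mx !add0r !mulNmx addrK a0.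
  by rewrite -rowE [row i s]mx11_scalar mxE subrr raddf0.
move: uB; rewrite E unitmx_mul => /andP[_ uB].
apply: change_of_variablesM; last exact: change_of_variables_pivot.
apply: change_of_variables_ublock; first exact: oner_neq0.
exact: change_of_variables1.
Qed.

End linear_change_of_variables.

(** * Positive definite matrices and Gaussian densities *)

Section gaussian_density.
Context {R : realType}.

(** The quadratic form at [v] is that of [S] at [C^T *m v], which is nonzero because [C^T] is
    injective. *)
Lemma posdefmx_congr m n (C : 'M[R]_(m, n)) (S : 'M[R]_n) :
  row_free C -> posdefmx S -> posdefmx (C *m S *m C^T).
Proof.
move=> Cfree [symS posS]; split; first by rewrite !trmx_mul trmxK symS mulmxA.
move=> v v0; have Cv0 : C^T *m v != 0.
  by rewrite -trmx_eq0 trmx_mul trmxK mulmx_free_eq0// trmx_eq0.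
by have := posS _ Cv0; rewrite trmx_mul trmxK !mulmxA.
Qed.

(* The induction eliminates the first variable and recurses on the Schur
   complement. *)
Lemma posdefmx_cholesky n (S : 'M[R]_n) : posdefmx S ->
  exists2 A : 'M[R]_n, A \in unitmx & S = A *m A^T.
Proof.
elim: n S => [|n IHn] S pS.
  by exists 0; [rewrite unitmxE det_mx00 unitr1|rewrite [LHS]flatmx0 mul0mx].
move: pS; rewrite -[S](@submxK _ 1 n 1 n) [ulsubmx _]mx11_scalar.
move: (ulsubmx _ _ _) (ursubmx _) (dlsubmx _) (drsubmx _) => a r s B pS.
have rE : r = s^T.
  have [+ _] := pS; rewrite (@tr_block_mx _ 1 n 1 n).
  by move=> /(@eq_block_mx _ 1 n 1 n)[].
(* Congruence by [C0] extracts the corner [a], which is therefore positive. *)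
subst r; pose C0 : 'M[R]_(1, 1 + n) := row_mx 1%:M 0.
have a0 : 0 < a.
  have C0free : row_free C0.
    apply/row_freeP; exists (col_mx 1%:M 0).
    by rewrite mul_row_col mulmx1 mul0mx addr0.
  have [_ /(_ 1%:M)] := posdefmx_congr C0free pS.
  rewrite (@mul_row_block _ 1 1 n 1 n) !mul1mx !mul0mx !addr0 tr_row_mx.
  rewrite trmx1 (@mul_row_col _ 1 1 n) trmx0 mulmx0 addr0 mulmx1 mul1mx mulmx1.
  by rewrite mxE eqxx mulr1n; apply; rewrite -mxrank_eq0 mxrank1.
(* Congruence by [C1] yields the Schur complement of [a], so that it is positive definite too. *)
pose C1 : 'M[R]_(n, 1 + n) := row_mx (- (a^-1 *: s)) 1%:M.
have C1free : row_free C1.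
  apply/row_freeP; exists (col_mx 0 1%:M).
  by rewrite mul_row_col mulmx1 mulmx0 add0r.
have := posdefmx_congr C1free pS.
rewrite (@mul_row_block _ n 1 n 1 n) !mul1mx tr_row_mx trmx1.
rewrite (@mul_row_col _ n 1 n) mulmx1 mul_mx_scalar scalerN scalerA.
rewrite divff ?gt_eqF// scale1r addNr mul0mx add0r => /IHn[A uA AE].
pose q := Num.sqrt a; have q0 : q != 0 by rewrite gt_eqF// sqrtr_gt0.
have qq : q * q = a by rewrite -expr2 sqr_sqrtr// ltW.
exists (block_mx q%:M 0 (q^-1 *: s) A : 'M[R]_(1 + n)).
  by rewrite unitmxE (@det_lblock _ 1 n) det_scalar1 unitrM unitfE q0 -unitmxE.
rewrite (@tr_block_mx _ 1 n 1 n) (@mulmx_block _ 1 n 1 n 1 n).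
rewrite tr_scalar_mx -scalar_mxM qq trmx0 !mulmx0 !mul0mx !addr0.
rewrite -[A *m _]AE linearZ/= mul_scalar_mx scalerA divff// scale1r.
rewrite mul_mx_scalar scalerA divff// scale1r -scalemxAl -scalemxAr scalerA.
by rewrite -invfM qq mulNmx -scalemxAl addrA subrr add0r.
Qed.

Lemma posdefmx_det_gt0 n (S : 'M[R]_n) : posdefmx S -> 0 < \det S.
Proof.
move=> /posdefmx_cholesky[A uA ->]; rewrite det_mulmx det_tr -expr2.
by rewrite exprn_even_gt0//= -unitfE -unitmxE.
Qed.

Lemma posdefmx_unitmx n (S : 'M[R]_n) : posdefmx S -> S \in unitmx.
Proof. by move=> /posdefmx_det_gt0; rewrite unitmxE unitfE => /gt_eqF ->. Qed.

Lemma mulmx1_invmx n (A B : 'M[R]_n) : A *m B = 1%:M -> invmx A = B.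
Proof.
move=> AB1; have [uA _] := mulmx1_unit AB1.
by rewrite -[LHS]mulmx1 -AB1 mulKmx.
Qed.

Lemma mvn_pdf_ge0 n (mu : 'cV[R]_n) (S : 'M[R]_n) x : 0 <= mvn_pdf mu S x.
Proof. by rewrite mulr_ge0 ?expR_ge0 ?invr_ge0. Qed.

Lemma measurable_mvn_pdf n (mu : 'cV[R]_n) (S : 'M[R]_n) :
  measurable_fun setT (mvn_pdf mu S).
Proof.
apply: measurable_funM => //; apply: measurableT_comp => //.
rewrite (_ : (fun _ => _) = (fun x : 'cV[R]_n =>
    - (\sum_k (\sum_j (x j ord0 - mu j ord0) * invmx S j k)
        * (x k ord0 - mu k ord0)) / 2)); last first.
  apply/funext => x; congr (- _ / _); rewrite !mxE; apply: eq_bigr => k _.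
  by rewrite !mxE; congr (_ * _); apply: eq_bigr => j _; rewrite !mxE.
apply: measurable_funM => //; apply: measurableT_comp => //.
apply: measurable_sum => k; apply: measurable_funM.
  apply: measurable_sum => j; apply: measurable_funM => //.
  by apply: measurable_funB => //; exact: measurable_coord.
by apply: measurable_funB => //; exact: measurable_coord.
Qed.

(** The quadratic form is unchanged by the substitution, and [|\det B|] cancels the square root of
    the factor [\det B ^+ 2] gained by the covariance determinant. *)
Lemma mvn_pdf_affine n (B S : 'M[R]_n) (t mu x : 'cV[R]_n) :
  B \in unitmx -> S \in unitmx ->
  `|\det B| * mvn_pdf (B *m mu + t) (B *m S *m B^T) (B *m x + t) =
  mvn_pdf mu S x.
Proof.
move=> uB uS; have dB0 : `|\det B| != 0 by rewrite normr_eq0 -unitfE -unitmxE.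
rewrite /mvn_pdf mulrA; congr (_ * expR (- _ / _)).
  rewrite !det_mulmx det_tr.
  rewrite (_ : _ * (_ * _) = \det B ^+ 2 * ((2 * pi) ^+ n * \det S)).
    by rewrite sqrtrM ?sqr_ge0// sqrtr_sqr invfM mulVKf.
  by rewrite expr2; ring.
rewrite opprD addrACA subrr addr0 -mulmxBr trmx_mul.
congr (fun_of_matrix _ _ _).
rewrite (@mulmx1_invmx _ _ (invmx B^T *m invmx S *m invmx B)).
  by rewrite !mulmxA mulmxK ?unitmx_tr// -!mulmxA mulKmx// !mulmxA mulmxK.
by rewrite !mulmxA mulmxK ?unitmx_tr// mulmxK// mulmxV.
Qed.

(** Uncorrelated Gaussian blocks are independent: the determinant, the inverse and the quadratic
    form of a block diagonal covariance all split. *)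
Lemma mvn_pdf_block m k (m1 u : 'cV[R]_m) (m2 v : 'cV[R]_k)
    (S1 : 'M[R]_m) (S2 : 'M[R]_k) :
  0 < \det S1 -> 0 < \det S2 ->
  mvn_pdf (col_mx m1 m2) (block_mx S1 0 0 S2) (col_mx u v) =
  mvn_pdf m1 S1 u * mvn_pdf m2 S2 v.
Proof.
move=> d1 d2; rewrite /mvn_pdf det_ublock exprD mulrACA.
rewrite sqrtrM; last by rewrite mulr_ge0// ltW// exprn_gt0// mulr_gt0// pi_gt0.
rewrite invfM [RHS]mulrACA -expRD; congr (_ * expR _).
have -> : invmx (block_mx S1 0 0 S2) = block_mx (invmx S1) 0 0 (invmx S2).
  apply: mulmx1_invmx; rewrite mulmx_block !mul0mx !mulmx0 !addr0 !add0r.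
  by rewrite !mulmxV ?unitmxE ?unitfE ?gt_eqF// -scalar_mx_block.
rewrite opp_col_mx add_col_mx tr_col_mx mul_row_block !mulmx0 addr0 add0r.
by rewrite mul_row_col mxE opprD mulrDl.
Qed.

End gaussian_density.

(** * Total mass and affine images of Gaussian densities *)

Section gaussian_integration.
Context {R : realType}.

Lemma integral_affine_cV n (B : 'M[R]_n) (t : 'cV[R]_n)
    (g : 'cV[R]_n -> \bar R) : B \in unitmx ->
  measurable_fun setT g -> (forall x, 0 <= g x)%E ->
  (\int[lebesgue_cV R n]_x g x =
   `|\det B|%R%:E * \int[lebesgue_cV R n]_x g (B *m x + t)%R)%E.
Proof.
move=> uB mg g0; rewrite (integral_translation_cV t)//.
apply: (change_of_variables_unitmx uB) => //.
apply: (measurableT_comp mg); rewrite (_ : (fun _ => _) =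
  (fun x : 'cV[R]_n => 1%:M *m x + t)); first exact: measurable_mulmx_addr.
by apply/funext => x; rewrite mul1mx.
Qed.

Lemma measurable_EFin_mvn_pdf n (mu : 'cV[R]_n) (S : 'M[R]_n) :
  measurable_fun setT (fun x => (mvn_pdf mu S x)%:E).
Proof. by apply/measurable_EFinP; exact: measurable_mvn_pdf. Qed.

Lemma mvn_pdf_std1 (a : R) :
  mvn_pdf 0 (1%:M : 'M[R]_1) a%:M = normal_pdf 0 1 a.
Proof.
rewrite /mvn_pdf normal_pdfE ?oner_neq0// /normal_peak /normal_fun.
rewrite invmx1 mulmx1 !subr0 det1 mulr1 expr1 expr1n mul1r mulr_natl.
by rewrite tr_scalar_mx -scalar_mxM mxE eqxx mulr1n expr2.
Qed.

(** The first coordinate splits off as an independent standard normal of mass 1. *)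
Lemma integral_mvn_pdf_std n :
  (\int[lebesgue_cV R n]_x (mvn_pdf 0 1%:M x)%:E = 1)%E.
Proof.
elim: n => [|n IHn].
  rewrite integral_cV0; last exact: measurable_EFin_mvn_pdf.
  rewrite /mvn_pdf expr0 det_mx00 mulr1 sqrtr1 invr1 mul1r subr0 trmx0.
  by rewrite mulmx0 mxE oppr0 mul0r expR0.
rewrite integral_cons_cV; last 2 first.
- exact: measurable_EFin_mvn_pdf.
- by move=> x; rewrite lee_fin mvn_pdf_ge0.
rewrite -(integral_normal_pdf 0 1); apply: eq_integral => a _.
have pdfE (v : 'cV[R]_n) : mvn_pdf 0 1%:M (cons_cV (a, v)) =
    normal_pdf 0 1 a * mvn_pdf 0 1%:M v :> R.
  have := @mvn_pdf_block R 1 n 0 a%:M 0 v 1%:M 1%:M.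
  by rewrite !det1 col_mx0 -scalar_mx_block mvn_pdf_std1; apply.
under eq_integral => v _ do rewrite pdfE EFinM.
rewrite ge0_integralZl_EFin//.
- by rewrite IHn mule1.
- by move=> v _; rewrite lee_fin mvn_pdf_ge0.
- exact: measurable_EFin_mvn_pdf.
- exact: normal_pdf_ge0.
Qed.

(** With [S = A *m A^T], the substitution [A *m x + mu] reduces to the standard density. *)
Lemma integral_mvn_pdf n (mu : 'cV[R]_n) (S : 'M[R]_n) : posdefmx S ->
  (\int[lebesgue_cV R n]_x (mvn_pdf mu S x)%:E = 1)%E.
Proof.
move=> /posdefmx_cholesky[A uA ->].
rewrite (integral_affine_cV mu uA); last 2 first.
- exact: measurable_EFin_mvn_pdf.
- by move=> x; rewrite lee_fin mvn_pdf_ge0.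
rewrite -ge0_integralZl_EFin//; last 2 first.
- by move=> x _; rewrite lee_fin mvn_pdf_ge0.
- exact: measurableT_comp (measurable_EFin_mvn_pdf _ _)
    (measurable_mulmx_addr _ _).
rewrite -(integral_mvn_pdf_std n); apply: eq_integral => x _.
rewrite -EFinM -(mvn_pdf_affine mu 0 x uA (unitmx1 _ _)) mulmx0 add0r.
by rewrite mulmx1.
Qed.

(** The other factors, times the inverse of the product, form a right inverse of [C]. *)
Lemma unitmx_congr_row_free m n (C : 'M[R]_(m, n)) (S : 'M[R]_n) :
  C *m S *m C^T \in unitmx -> row_free C.
Proof.
move=> uCS; apply/row_freeP; exists (S *m C^T *m invmx (C *m S *m C^T)).
by rewrite !mulmxA mulmxV.
Qed.

(** The rows of [D] are a basis of the left kernel of [S *m C^T]; that matrix has rank [m], so its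
    kernel has dimension [k]. *)
Lemma orthogonal_completion m k (C : 'M[R]_(m, m + k)) (S : 'M[R]_(m + k)) :
  row_free C -> posdefmx S ->
  exists2 D : 'M[R]_(k, m + k), row_free D & D *m S *m C^T = 0.
Proof.
move=> Cfree pS; pose K := kermx (S *m C^T).
have rK : \rank K = k.
  have fullS : row_full S by rewrite row_full_unit posdefmx_unitmx.
  by rewrite mxrank_ker (eqmxMfull _ fullS) mxrank_tr (eqP Cfree) addKn.
(* The rank is generalized to [r] so that the basis, which has [\rank K] rows, can be retyped with
   [k] rows. *)
have basis r : \rank K = r ->
    exists2 D : 'M[R]_(r, m + k), (D <= K)%MS & row_free D.
  by move=> <-; exists (row_base K); [rewrite eq_row_base|exact: row_base_free].
have [D DK Dfree] := basis _ rK.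
by exists D => //; apply/eqP; rewrite -mulmxA; apply/eqP/sub_kermxP.
Qed.

Lemma integral_mvn_pdf_affine_block m k (C : 'M[R]_(m, m + k)) (c : 'cV[R]_m)
    (mu : 'cV[R]_(m + k)) (S : 'M[R]_(m + k)) (A : set 'cV[R]_m) :
  row_free C -> posdefmx S -> measurable A ->
  (\int[lebesgue_cV R (m + k)]_(x in
       (fun x : 'cV[R]_(m + k) => C *m x + c)%R @^-1` A)
     (mvn_pdf mu S x)%:E =
   \int[lebesgue_cV R m]_(y in A)
     (mvn_pdf (C *m mu + c)%R (C *m S *m C^T)%R y)%:E)%E.
Proof.
move=> Cfree pS mA; have [D Dfree DSC] := orthogonal_completion Cfree pS.
pose S1 := C *m S *m C^T; pose S2 := D *m S *m D^T.
have pS1 : posdefmx S1 by exact: posdefmx_congr.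
have pS2 : posdefmx S2 by exact: posdefmx_congr.
pose B := col_mx C D; pose t := col_mx c (0 : 'cV[R]_k).
have CSD : C *m S *m D^T = 0.
  have [symS _] := pS.
  by apply: trmx_inj; rewrite trmx0 !trmx_mul trmxK symS mulmxA.
have BSB : B *m S *m B^T = block_mx S1 0 0 S2.
  by rewrite /B tr_col_mx mul_col_mx mul_col_row CSD DSC.
(* [B] is a factor of a square product whose determinant, that of [S1] times that of [S2], is
   positive. *)
have uB : B \in unitmx.
  have : B *m S *m B^T \in unitmx.
    rewrite BSB unitmxE unitfE det_ublock.
    by rewrite gt_eqF// mulr_gt0// posdefmx_det_gt0.
  by rewrite !unitmx_mul => /andP[/andP[]].
(* The two sides meet at the integral of [h]: the substitution [B *m x + t] turns it into the left
   one, and integrating out the lower block of [y] into the right one. *)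
pose h (y : 'cV[R]_(m + k)) : \bar R :=
  (\1_A (usubmx y) * mvn_pdf (B *m mu + t) (B *m S *m B^T) y)%:E.
have mh : measurable_fun setT h.
  apply/measurable_EFinP; apply: measurable_funM; last first.
    exact: measurable_mvn_pdf.
  apply: (measurableT_comp (measurable_indic _)) => //.
  apply: measurable_fun_matrix => i j.
  rewrite (_ : (fun _ => _) = fun y : 'cV[R]_(m + k) => y (lshift k i) j).
    exact: measurable_coord.
  by apply/funext => y; rewrite mxE.
have h0 y : (0 <= h y)%E by rewrite lee_fin mulr_ge0// mvn_pdf_ge0.
have mCA : measurable ((fun x : 'cV[R]_(m + k) => C *m x + c) @^-1` A).
  by rewrite -[X in measurable X]setTI; exact: measurable_mulmx_addr.
transitivity (\int[lebesgue_cV R (m + k)]_y h y)%E.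
  rewrite (integral_affine_cV t uB mh h0) -ge0_integralZl_EFin//; last first.
    exact: measurableT_comp mh (measurable_mulmx_addr _ _).
  rewrite [LHS]integral_mkcond; apply: eq_integral => x _.
  rewrite /h -EFinM mulrCA mvn_pdf_affine// ?posdefmx_unitmx// patchE.
  rewrite {1}/B {1}/t mul_col_mx add_col_mx col_mxKu indicE.
  have -> : (C *m x + c \in A) =
      (x \in (fun x : 'cV[R]_(m + k) => C *m x + c) @^-1` A).
    by apply/idP/idP; rewrite !inE.
  by case: ifPn => _; rewrite ?mul1r ?mul0r.
rewrite (integral_col_mx mh h0) [RHS]integral_mkcond; apply: eq_integral => u _.
transitivity (\int[lebesgue_cV R k]_v (
    (\1_A u * mvn_pdf (C *m mu + c) S1 u)%R%:E *
    (mvn_pdf (D *m mu)%R S2 v)%:E))%E.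
  apply: eq_integral => v _; rewrite /h col_mxKu BSB /B /t.
  rewrite mul_col_mx add_col_mx.
  by rewrite addr0 mvn_pdf_block ?posdefmx_det_gt0// mulrA EFinM.
rewrite ge0_integralZl_EFin//; last 3 first.
- by move=> v _; rewrite lee_fin mvn_pdf_ge0.
- exact: measurable_EFin_mvn_pdf.
- by rewrite mulr_ge0// mvn_pdf_ge0.
rewrite integral_mvn_pdf// mule1 patchE indicE.
by case: ifPn => _; rewrite ?mul1r ?mul0r.
Qed.

End gaussian_integration.

(** Full row rank forces [m <= n], so [n] can be written as [m + k], leaving [k] rows to complete
    [C]. *)
Lemma integral_mvn_pdf_affine (R : realType) m n (C : 'M[R]_(m, n))
    (c : 'cV[R]_m) (mu : 'cV[R]_n) (S : 'M[R]_n) (A : set 'cV[R]_m) :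
  C *m S *m C^T \in unitmx -> posdefmx S -> measurable A ->
  (\int[lebesgue_cV R n]_(x in (fun x : 'cV[R]_n => C *m x + c)%R @^-1` A)
     (mvn_pdf mu S x)%:E =
   \int[lebesgue_cV R m]_(y in A)
     (mvn_pdf (C *m mu + c)%R (C *m S *m C^T)%R y)%:E)%E.
Proof.
move=> /unitmx_congr_row_free Cfree.
have lemn : (m <= n)%N by rewrite -(eqP Cfree) rank_leq_col.
have [k nE] : exists k, n = (m + k)%N by exists (n - m)%N; rewrite subnKC.
by subst n; exact: integral_mvn_pdf_affine_block.
Qed.

(** * Orthants and activation patterns *)

Lemma measurable_orthant (R : realType) n (z : 'cV[bool]_n) :
  measurable (orthant z : set 'cV[R]_n).
Proof.
rewrite (_ : orthant z = \bigcap_(i in [set: 'I_n])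
    ((fun v : 'cV[R]_n => 0 < v i ord0) @^-1` [set z i ord0])); last first.
  apply/seteqP; split => v; first by move=> <- i _ /=; rewrite mxE.
  by move=> h; apply/matrixP => i j; rewrite (ord1 j) mxE; exact: (h i).
apply: fin_bigcap_measurable => // i _; rewrite -[X in measurable X]setTI.
by apply: measurable_fun_ltr => //; exact: measurable_coord.
Qed.

Section activation.
Context {R : realType} (n : nat -> nat).
Variables (W : forall l, 'M[R]_(n l.+1, n l)) (b : forall l, 'cV[R]_(n l.+1)).
Variables (m : nat) (zeta : 'cV[bool]_(stacked_dim n m)).

Lemma relu_mask k (v : 'cV[R]_k) : relu v = mask_mx (sign_cV v) *m v.
Proof.
apply/matrixP => i j; rewrite (ord1 j) mul_diag_mx !mxE.
by case: ltP => _; rewrite ?mul1r ?mul0r.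
Qed.

Lemma pattern_blockE (l : 'I_m) : pattern_block zeta l = submxcol zeta l.
Proof.
case: l => l lt_lm; rewrite /pattern_block /=; case: eqP => // lt_lm'.
by rewrite (bool_irrelevance lt_lm' lt_lm).
Qed.

(** The blocks are indexed by natural numbers on the right, which permits induction along the
    layers. *)
Lemma sign_mxcol_eq (h : forall l, 'cV[R]_(n l.+1)) :
  \mxcol_(l < m) sign_cV (h l) = zeta <->
  forall l, (l < m)%N -> sign_cV (h l) = pattern_block zeta l.
Proof.
split=> [zE l lt_lm|hE].
  by rewrite -[l]/(val (Ordinal lt_lm)) pattern_blockE -zE mxcolK.
by apply/mxcolP => l; rewrite mxcolK -pattern_blockE hE.
Qed.

Let affine (x : 'cV[R]_(n 0%N)) l :=
  affine_mx W zeta l *m x + affine_cV W b zeta l.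

(** Once the signs of layer [l] are the prescribed ones, [relu] acts there as the mask built into
    the affine recursion. *)
Lemma preactivation_affineS x l :
  preactivation W b x l = affine x l ->
  sign_cV (affine x l) = pattern_block zeta l ->
  preactivation W b x l.+1 = affine x l.+1.
Proof.
move=> hE aE; rewrite /= hE relu_mask aE /affine /=.
by rewrite mulmxDr !mulmxA mulmxDr !mulmxA addrA.
Qed.

(** In either direction, the signs assumed at layer [l] are what carries the equality of
    preactivation and surrogate on to layer [l.+1]. *)
Lemma sign_preactivationE x :
  (forall l, (l < m)%N ->
    sign_cV (preactivation W b x l) = pattern_block zeta l) <->
  (forall l, (l < m)%N -> sign_cV (affine x l) = pattern_block zeta l).
Proof.
split=> hE.
  have E l : (l < m)%N -> preactivation W b x l = affine x l.
    elim: l => // l IHl lt_lm; have /IHl El := ltnW lt_lm.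
    by apply: preactivation_affineS => //; rewrite -El hE// ltnW.
  by move=> l lt_lm; rewrite -E// hE.
have E l : (l < m)%N -> preactivation W b x l = affine x l.
  elim: l => // l IHl lt_lm; have /IHl El := ltnW lt_lm.
  by apply: preactivation_affineS => //; rewrite hE// ltnW.
by move=> l lt_lm; rewrite E// hE.
Qed.

Lemma sign_stackedE x :
  sign_cV (stacked_mx W zeta m *m x + stacked_cV W b zeta m) =
  \mxcol_(l < m) sign_cV (affine x l).
Proof.
rewrite /stacked_mx /stacked_cV mxcol_mul -mxcolD; apply/mxcolP => l.
(* Signs are entrywise, so they commute with the extraction of a block. *)
rewrite mxcolK; transitivity (sign_cV (submxcol
    (\mxcol_(j < m) affine x j : 'cV[R]_(stacked_dim n m)) l)).
  by apply/matrixP => i j; rewrite !mxE.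
by rewrite mxcolK.
Qed.

End activation.

Lemma activation_pattern_eq (R : realType) (n : nat -> nat)
    (W : forall l, 'M[R]_(n l.+1, n l)) (b : forall l, 'cV[R]_(n l.+1))
    (L : nat) (zeta : 'cV[bool]_(stacked_dim n L.-1)) (x : 'cV[R]_(n 0%N)) :
  activation_pattern W b L x = zeta <->
  orthant zeta (stacked_mx W zeta L.-1 *m x + stacked_cV W b zeta L.-1).
Proof.
rewrite /orthant /= sign_stackedE.
apply: iff_trans (sign_mxcol_eq _ _) _.
apply: iff_trans (sign_preactivationE _ _ _ _) _.
exact: iff_sym (sign_mxcol_eq _ _).
Qed.

(** * Pattern probabilities under a Gaussian mixture *)

Theorem proposition1 (R : realType) (L : nat) (n : nat -> nat)
    (W : forall l : nat, 'M[R]_(n l.+1, n l))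
    (b : forall l : nat, 'cV[R]_(n l.+1))
    (K : nat) (alpha : 'I_K -> R) (mu : 'I_K -> 'cV[R]_(n 0%N))
    (Sigma : 'I_K -> 'M[R]_(n 0%N))
    (d : measure_display) (T : measurableType d) (P : probability T R)
    (X : {RV P >-> 'cV[R]_(n 0%N)})
    (zeta' : 'cV[bool]_(stacked_dim n L.-1)) :
  (2 <= L)%N ->
  (forall k, posdefmx (Sigma k)) ->
  (forall k, 0 < alpha k) ->
  \sum_(k < K) alpha k = 1 ->
  has_density X (fun x => \sum_(k < K) alpha k * mvn_pdf (mu k) (Sigma k) x) ->
  let C := stacked_mx W zeta' L.-1 in
  let c := stacked_cV W b zeta' L.-1 in
  let mu' k := C *m mu k + c in
  let Sigma' k := C *m Sigma k *m C^T in
  (forall k, Sigma' k \in unitmx) ->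
  P [set w | activation_pattern W b L (X w) = zeta'] =
  (\sum_(k < K) (alpha k)%:E *
     \int[lebesgue_cV R (stacked_dim n L.-1)]_(x in orthant zeta')
       (mvn_pdf (mu' k) (Sigma' k) x)%:E)%E.

Proof.
move=> _ pS alpha0 _ densX C c mu' Sigma' uS'.
(* [A] is the set of inputs with pattern [zeta'], so the probability sought is its mass under the
   law of [X]. *)
pose A := (fun x : 'cV[R]_(n 0%N) => C *m x + c) @^-1` orthant zeta'.
have mA : measurable A.
  rewrite -[X in measurable X]setTI; apply: measurable_mulmx_addr => //.
  exact: measurable_orthant.
rewrite (_ : [set w | _] = X @^-1` A); last first.
  apply/seteqP; split => w /=;
    have [h1 h2] := @activation_pattern_eq _ _ W b L zeta' (X w);
    [exact: h1|exact: h2].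
rewrite -[LHS]/(distribution P X A) densX//.
under eq_integral do rewrite -sumEFin.
rewrite ge0_integral_sum//; last 2 first.
- move=> k; apply: measurable_funTS; apply/measurable_EFinP.
  by apply: measurable_funM => //; exact: measurable_mvn_pdf.
- by move=> k x _; rewrite lee_fin mulr_ge0 ?mvn_pdf_ge0// ltW.
(* Each mixture component is now pushed forward separately. *)
apply: eq_bigr => k _; under eq_integral do rewrite EFinM.
rewrite ge0_integralZl_EFin//; last 3 first.
- by move=> x _; rewrite lee_fin mvn_pdf_ge0.
- by apply: measurable_funTS; exact: measurable_EFin_mvn_pdf.
- exact: ltW.
by rewrite (integral_mvn_pdf_affine _ _ (uS' k) (pS k) (measurable_orthant _)).
Qed.
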